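(* For all positive integers $k\le r$ there exists $\alpha_0>0$ such that for every $\alpha\in(0,\alpha_0)$ there exists $n_0$ such that for every $n\ge n_0$ the following holds. Let $V$ be partitioned into $r$ parts $V_1,\dots,V_r$ each of size $n$, and let $J$ be a $k$-system on $V$ which is partite with respect to this partition and satisfies $$\delta^*(J) \geq \left(n, \left(\tfrac{k-1}{k} - \alpha\right)n, \left(\tfrac{k-2}{k} - \alpha\right) n, \dots, \left(\tfrac{1}{k} - \alpha\right) n\right).$$ Then $J_k$ contains a matching which covers all but at most $9k^2r\alpha n$ vertices of $J$.
   Context: A $k$-system is a hypergraph $J$ (identified with its edge set) in which every edge has size at most $k$ and $\emptyset\in J$; $J_r$ denotes the $r$-graph of its edges of size $r$. A set is partite with respect to a partition if it has at most one vertex in each part; $J$ is partite if all its edges are. The partite minimum $j$-degree is $\delta^*_j(J) = \min_{e\in J_j}\min_{i:\, e\cap V_i=\emptyset} |\{v\in V_i: e\cup\{v\}\in J\}|$, and $\delta^*(J)=(\delta^*_0(J),\dots,\delta^*_{k-1}(J))$, compared pointwise. A matching is a set of pairwise disjoint edges. *)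

(* Defs.v *)
From HB Require Import structures.
From mathcomp Require Import all_boot all_order all_algebra.
From mathcomp Require Import reals.
Set Implicit Arguments. Unset Strict Implicit. Unset Printing Implicit Defensive.
Import Order.TTheory GRing.Theory Num.Theory.

Section Hypergraphs.
Variables (T : finType) (r : nat) (part : T -> 'I_r).

Definition Vpart (i : 'I_r) : {set T} := [set v | part v == i].

Definition k_system (k : nat) (J : {set {set T}}) : Prop :=
  set0 \in J /\ forall e, e \in J -> #|e| <= k.

Definition layer (J : {set {set T}}) (j : nat) : {set {set T}} :=
  [set e in J | #|e| == j].

Definition partite_set (e : {set T}) : Prop :=
  forall i, #|e :&: Vpart i| <= 1.

Definition partite (J : {set {set T}}) : Prop :=
  forall e, e \in J -> partite_set e.

Definition ext_nbhd (J : {set {set T}}) (e : {set T}) (i : 'I_r) : {set T} :=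
  [set v in Vpart i | v |: e \in J].

(* δ*(J) >= d pointwise (for coordinates j = 0..k-1):
   min over e ∈ J_j and parts V_i disjoint from e of |ext_nbhd J e i| is >= d j *)
Definition partite_mindeg_ge (R : numDomainType) (k : nat)
    (J : {set {set T}}) (d : nat -> R) : Prop :=
  forall j, j < k -> forall e, e \in layer J j ->
  forall i, [disjoint e & Vpart i] -> (d j <= (#|ext_nbhd J e i|)%:R)%R.

Definition matching (M : {set {set T}}) : Prop :=
  forall e1 e2, e1 \in M -> e2 \in M -> e1 != e2 -> [disjoint e1 & e2].

End Hypergraphs.

(* Main.v *)
(* Take a maximum matching M and suppose that it leaves more than 9 k^2 r alpha n
   vertices uncovered. Call the edges of M and the uncovered singletons cells, and
   sample N cells at random, N being a large constant. With probability at least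
   1/2 the sampled template inherits the degree conditions up to a small error.
   In such a template every nonnegative vertex weighting admits a cheap edge,
   found greedily; by multiplicative weights there is a constant D and a family
   of more than D K edges, K being the number of edges of M in the template,
   which uses each template vertex at most D times. A positive proportion of all
   templates have the same type, so by Erdős's theorem the D-fold blow-up of one
   type occurs. In this blow-up the fractional matching becomes an honest one
   which is larger than the D K edges of M it replaces, a contradiction. *)
Require Import Defs.
From HB Require Import structures.
From mathcomp Require Import all_boot all_order all_algebra.
From mathcomp Require Import reals.
From mathcomp Require Import sequences exp.
From mathcomp Require Import ring lra zify.
Set Implicit Arguments.
Unset Strict Implicit.
Unset Printing Implicit Defensive.
Import Order.TTheory GRing.Theory Num.Theory.
Local Open Scope ring_scope.

(** * Finite averaging and complete multipartite subgraphs *)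

Lemma card_bigcup_le (I Z : finType) (S : {set I}) (G : I -> {set Z}) :
  (#|\bigcup_(i in S) G i| <= \sum_(i in S) #|G i|)%N.
Proof.
elim/big_rec2: _ => [|i x A _ leA]; first by rewrite cards0.
by apply: leq_trans (leq_card_setU _ _) _; rewrite leq_add2l.
Qed.

Lemma pigeonhole_cover (I Z : finType) (S : {set I}) (Y : {set Z}) (G : I -> {set Z}) :
  (0 < #|Y|)%N -> (forall y, y \in Y -> exists2 i, i \in S & y \in G i) ->
  exists2 i, i \in S & (#|Y| <= #|S| * #|G i|)%N.
Proof.
move=> Y0 cov; case: (pickP [pred i in S | (#|Y| <= #|S| * #|G i|)%N]) => [i /andP[]|none].
  by exists i.
have: (#|S| * #|Y| <= \sum_(i in S) (#|S| * #|G i|))%N.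
  rewrite -big_distrr leq_mul2l /=; apply/orP; right.
  apply: leq_trans (card_bigcup_le S G).
  by apply/subset_leq_card/subsetP => y /cov [i iS yG]; apply/bigcupP; exists i.
have lt i : i \in S -> (#|S| * #|G i| < #|Y|)%N.
  by move=> iS; have := none i; rewrite inE iS /= ltnNge => ->.
have [y yY] := card_gt0P Y0; have [i0 i0S _] := cov y yY.
rewrite leqNgt -sum_nat_const; case/negP.
rewrite (bigD1 i0) //= [X in (_ < X)%N](bigD1 i0) //= -addSn.
by rewrite leq_add ?lt // leq_sum // => i /andP[/lt/ltnW].
Qed.

(** A reverse Markov inequality: terms of size at least D count for at most a each, the others for
    at most D. It turns a large average into many large terms. *)
Lemma sum_le_card_large (R : realFieldType) (I : finType) (w : I -> R) (a D : R) :
  0 <= D -> (forall i, w i <= a) ->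
  \sum_i w i <= #|[set i | D <= w i]|%:R * a + #|I|%:R * D.
Proof.
move=> D0 wa; rewrite (bigID (fun i => D <= w i)) /= lerD //.
  rewrite -sum1dep_card natr_sum mulr_suml ler_sum // => i _.
  by rewrite mul1r wa.
apply: (@le_trans _ _ (\sum_(i | ~~ (D <= w i)) D)).
  by apply: ler_sum => i; rewrite -ltNge => /ltW.
rewrite big_mkcond /= -sum1_card natr_sum mulr_suml ler_sum // => i _.
by rewrite mul1r; case: ifP.
Qed.

Lemma sum_tuple_cons (C : finType) N (F : N.+1.-tuple C -> nat) :
  (\sum_t F t = \sum_x \sum_(t : N.-tuple C) F [tuple of x :: t])%N.
Proof.
rewrite pair_big /= (reindex (fun p : C * N.-tuple C => [tuple of p.1 :: p.2])) //=.
exists (fun t => (thead t, [tuple of behead t])) => [[x t] _ | t _] /=.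
  by congr pair; apply: val_inj.
by rewrite [RHS]tuple_eta.
Qed.

Lemma card_pred_sum (I : finType) (P : pred I) : #|[set i | P i]| = (\sum_i P i)%N.
Proof. by rewrite -sum1dep_card big_mkcond; apply: eq_bigr => i _; case: (P i). Qed.

(* Erdős's theorem that dense N-partite N-graphs contain complete N-partite
   subgraphs with parts of size D. *)
Lemma blowup_tuple (R : realType) (D N : nat) (c : R) (f : nat) : 0 < c ->
  exists n0, forall (C : finType) (F : {set C}) (H : pred (seq C)),
    (n0 <= #|C|)%N -> (#|F| <= f)%N ->
    c * (#|C| ^ N)%:R <= #|[set t : N.-tuple C | H t]|%:R ->
    exists b : nat -> nat -> C,
    [/\ forall p q, (p < N)%N -> (q < D)%N -> b p q \notin F,
        forall p q p' q', (p < N)%N -> (p' < N)%N -> (q < D)%N -> (q' < D)%N ->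
          b p q = b p' q' -> p = p' /\ q = q' &
        forall phi, (forall p, (p < N)%N -> (phi p < D)%N) -> H (mkseq (fun p => b p (phi p)) N)].
Proof.
elim: N c f => [|N IH] c f c0.
  exists 1%N => C F H C0 _ cH.
  have [x0 _] := card_gt0P C0.
  exists (fun _ _ => x0); split=> // phi _.
  have /card_gt0P [t] : (0 < #|[set t : 0.-tuple C | H t]|)%N.
    by rewrite -(ltr_nat R); apply: lt_le_trans cH; rewrite expn0 mulr1.
  by rewrite inE tuple0.
(* Among a vertices of degree at least (c/2) m^N, a tuple has on average at least c a / 2 >= 2D
   neighbours, so many tuples have D of them. *)
pose a := (Num.bound (4 * D%:R / c)).+1.
have a0 : (0 < a)%N by [].
have aP : 4 * D%:R <= c * a%:R.
  have := archi_boundP (_ : 0 <= 4 * D%:R / c).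
  rewrite mulr_ge0 ?invr_ge0 ?(ltW c0) ?mulr_ge0 // => /(_ isT) /ltW.
  rewrite ler_pdivrMr // => /le_trans; apply.
  by rewrite [leLHS]mulrC ler_wpM2l ?(ltW c0) // ler_nat leqnSn.
have c'0 : 0 < c / 4 / (2 ^ a)%:R by rewrite !divr_gt0 // ltr0n expn_gt0.
have [n1 n1P] := IH _ (f + D)%N c'0.
pose n2 := Num.bound (2 * (a + f)%:R / c).
have n2P : 2 * (a + f)%:R <= c * n2%:R.
  have := archi_boundP (_ : 0 <= 2 * (a + f)%:R / c).
  rewrite mulr_ge0 ?invr_ge0 ?(ltW c0) ?mulr_ge0 // => /(_ isT) /ltW.
  by rewrite ler_pdivrMr // [leRHS]mulrC.
exists (maxn 1 (maxn n1 n2)) => C F H; rewrite !geq_max => /and3P[C0 Cn1 Cn2] Ff cH.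
set m := #|C| in C0 Cn1 Cn2 cH.
have mN0 : 0 < (m ^ N)%:R :> R by rewrite ltr0n expn_gt0 C0.
pose deg x := #|[set t : N.-tuple C | H (x :: t)]|.
have degm x : (deg x <= m ^ N)%N by rewrite -card_tuple max_card.
have sdeg : c * (m ^ N.+1)%:R <= (\sum_x deg x)%:R.
  apply: le_trans cH _; rewrite ler_nat card_pred_sum sum_tuple_cons.
  by apply: leq_sum => x _; rewrite /deg card_pred_sum.
have := @sum_le_card_large R C (fun x => (deg x)%:R) (m ^ N)%:R (c / 2 * (m ^ N)%:R).
rewrite -natr_sum; set X := [set x | _].
have c2 : 0 <= c / 2 * (m ^ N)%:R by rewrite mulr_ge0 ?divr_ge0 ?ltW.
have degR i : (deg i)%:R <= (m ^ N)%:R :> R by rewrite ler_nat.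
move/(_ c2 degR)/(le_trans sdeg); rewrite expnS natrM -/m => leX.
(* X consists of the first coordinates of degree at least (c/2) m^N. There are at least (c/2) m of
   them, so a of them remain outside F. *)
have Xbig : (a + f <= #|X|)%N.
  rewrite -(ler_nat R) -(ler_pM2r mN0).
  have : c * n2%:R * (m ^ N)%:R <= c * m%:R * (m ^ N)%:R.
    by rewrite ler_pM2r // ler_pM2l // ler_nat.
  have : 2 * (a + f)%:R * (m ^ N)%:R <= c * n2%:R * (m ^ N)%:R by rewrite ler_pM2r.
  lra.
have : (a <= #|X :\: F|)%N.
  rewrite cardsD; have := subset_leq_card (subsetIr X F); lia.
case/card_geqP => sA [uA szA sAX].
pose A := [set x in sA].
have cA : #|A| = a by rewrite cardsE; move/card_uniqP: uA ->.
pose w (t : N.-tuple C) := #|[set x in A | H (x :: t)]|.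
have wa t : (w t)%:R <= a%:R :> R.
  by rewrite ler_nat -cA; apply/subset_leq_card/subsetP => x; rewrite inE => /andP[].
have sw : (\sum_t w t = \sum_(x in A) deg x)%N.
  transitivity (\sum_(t : N.-tuple C) \sum_(x in A) H (x :: t))%N.
    apply: eq_bigr => t _; rewrite /w -sum1dep_card big_mkcondr /=.
    by apply: eq_bigr => x _; case: (H _).
  by rewrite exchange_big; apply: eq_bigr => x _; rewrite /deg card_pred_sum.
have := @sum_le_card_large R _ (fun t => (w t)%:R) a%:R D%:R (ler0n _ _) wa.
rewrite -natr_sum sw card_tuple -/m; set Y := [set t | _] => leY.
have geD : a%:R * (c / 2 * (m ^ N)%:R) <= (\sum_(x in A) deg x)%:R.
  rewrite natr_sum -cA -sum1_card natr_sum mulr_suml; apply: ler_sum => x xA.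
  by have := sAX x; rewrite -[x \in sA]inE -/A inE in xA *; rewrite xA mul1r => /(_ isT); rewrite !inE => /andP[].
have Ybig : c / 4 * (m ^ N)%:R <= #|Y|%:R.
  have aR0 : 0 < a%:R :> R by rewrite ltr0n.
  rewrite -(ler_pM2r aR0).
  have : 4 * D%:R * (m ^ N)%:R <= c * a%:R * (m ^ N)%:R by rewrite ler_pM2r.
  lra.
(* Every tuple of Y is completed by all of some D-subset B of A. There are at most 2^a such B, so
   one B serves a positive proportion of the tuples; it becomes the first part. *)
pose G (B : {set C}) := [set t : N.-tuple C | all (fun x => H (x :: t)) (enum B)].
have Y0 : (0 < #|Y|)%N.
  by rewrite -(ltr_nat R); apply: lt_le_trans Ybig; rewrite mulr_gt0 ?divr_gt0.
have [t|B BS leG] := @pigeonhole_cover _ _ [set B : {set C} | (B \subset A) && (#|B| == D)] Y G Y0.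
  rewrite inE ler_nat => /card_geqP [s [us ss sP]].
  exists [set x in s].
    rewrite inE cardsE; move/card_uniqP: us => ->; rewrite ss eqxx andbT.
    by apply/subsetP => x; rewrite inE => /sP; rewrite inE => /andP[].
  by rewrite inE; apply/allP => x; rewrite mem_enum inE => /sP; rewrite inE => /andP[].
move: BS; rewrite inE => /andP[BA /eqP BD].
have cG : c / 4 / (2 ^ a)%:R * (m ^ N)%:R <= #|G B|%:R.
  rewrite mulrAC ler_pdivrMr ?ltr0n ?expn_gt0 //.
  apply: le_trans Ybig _; rewrite -natrM ler_nat mulnC.
  apply: leq_trans leG _; rewrite leq_mul2r; apply/orP; right.
  rewrite -cA -card_powerset; apply/subset_leq_card/subsetP => E.
  by rewrite !inE => /andP[].
have FB : (#|F :|: B| <= f + D)%N.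
  by apply: leq_trans (leq_card_setU _ _) _; rewrite BD leq_add2r.
(* Forbidding B along with F in the induction keeps the later parts disjoint from the first; this is
   what F is for. *)
have [b [bF bI bH]] := n1P C (F :|: B) (fun t => all (fun x => H (x :: t)) (enum B)) Cn1 FB cG.
have [x0 _] := card_gt0P C0.
have szB : size (enum B) = D by rewrite -cardE.
have inB q : (q < D)%N -> nth x0 (enum B) q \in B.
  by move=> qD; rewrite -mem_enum mem_nth // szB.
exists (fun p q => if p is p'.+1 then b p' q else nth x0 (enum B) q); split.
- case=> [|p] q pN qD.
    have /(subsetP BA) := inB q qD; rewrite inE => /sAX.
    by rewrite inE => /andP[].
  by have := bF p q pN qD; rewrite inE negb_or => /andP[].
- case=> [|p] q [|p'] q' pN p'N qD q'D.
  + by move/eqP; rewrite nth_uniq ?szB ?enum_uniq // => /eqP.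
  + by move=> e; have := bF p' q' p'N q'D; rewrite -e inE inB ?orbT.
  + by move=> e; have := bF p q pN qD; rewrite e inE inB ?orbT.
  + by case/bI => // -> ->.
- move=> phi phiD; rewrite /mkseq /= -[1%N]/(1 + 0)%N iotaDl -map_comp.
  have /allP := bH (fun p => phi p.+1) (fun p pN => phiD p.+1 pN).
  by apply; rewrite mem_enum inB ?phiD.
Qed.

Lemma card_ffun_tuple (C : finType) N (H : {set {ffun 'I_N -> C}}) (P : pred (N.-tuple C)) :
  (forall f : {ffun 'I_N -> C}, f \in H -> P [tuple f i | i < N]) -> (#|H| <= #|[set t | P t]|)%N.
Proof.
move=> HP; pose F (f : {ffun 'I_N -> C}) := [tuple f i | i < N].
have Finj : injective F.
  by move=> f g e; apply/ffunP => p; rewrite -[f p](tnth_mktuple f) -[g p](tnth_mktuple g) -/(F f) e.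
rewrite -(card_imset (mem H) Finj); apply/subset_leq_card/subsetP => t /imsetP [f fH ->].
by rewrite inE; apply: HP.
Qed.

Lemma blowup (R : realType) (D N : nat) (c : R) : 0 < c ->
  exists n0, forall (C : finType) (H : {set {ffun 'I_N -> C}}),
    (n0 <= #|C|)%N -> c * (#|C| ^ N)%:R <= #|H|%:R ->
    exists2 b : 'I_N -> 'I_D -> C,
      forall p q p' q', b p q = b p' q' -> p = p' /\ q = q' &
      forall phi : 'I_N -> 'I_D, [ffun p => b p (phi p)] \in H.
Proof.
move=> c0; have [n0 n0P] := blowup_tuple D N 0 c0.
exists (maxn 1 n0) => C H; rewrite geq_max => /andP[C0 Cn0] cH.
have [x0 _] := card_gt0P C0.
have [||b [_ bI bH]] := n0P C set0 (fun s => [ffun p : 'I_N => nth x0 s p] \in H) Cn0.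
- by rewrite cards0.
- apply: le_trans cH _; rewrite ler_nat; apply: card_ffun_tuple => f fH.
  suff -> : [ffun p : 'I_N => nth x0 [tuple f i | i < N] p] = f by [].
  by apply/ffunP => p; rewrite ffunE -tnth_nth tnth_mktuple.
exists (fun p q => b p q).
  by move=> p q p' q' /bI [] // /val_inj -> /val_inj ->.
move=> phi.
pose phi' p := if insub p is Some p' then nat_of_ord (phi p') else 0%N.
have H1 := bH phi'.
have phi'E (p : 'I_N) : phi' p = phi p by rewrite /phi' valK.
have /H1 : forall p, (p < N)%N -> (phi' p < D)%N.
  by move=> p pN; rewrite (phi'E (Ordinal pN)).
suff -> : [ffun p : 'I_N => nth x0 (mkseq (fun q => b q (phi' q)) N) p] = [ffun p : 'I_N => b p (phi p)] by [].
by apply/ffunP => p; rewrite !ffunE nth_mkseq // phi'E.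
Qed.

(** * Fractional matchings by multiplicative weights *)

(** Give x the weight (1 + eta)^c, where c counts the chosen edges through x, and always choose an
    edge carrying at most a 1/nu share of the total. Each choice multiplies the total by at most 1 +
    eta/nu. *)
Lemma weights_potential (R : realFieldType) (A : finType) (E : {set {set A}}) (nu eta : R) (t : nat) :
  0 < nu -> 0 < eta ->
  (forall a : A -> R, (forall x, 0 <= a x) ->
     exists2 e, e \in E & nu * (\sum_(x in e) a x) <= \sum_x a x) ->
  exists es : seq {set A}, [/\ size es = t, {subset es <= E} &
    \sum_x (1 + eta) ^+ count (fun e : {set A} => x \in e) es
      <= #|A|%:R * (1 + eta / nu) ^+ t].
Proof.
move=> nu0 eta0 cov; elim: t => [|t [es [szes esE pot]]].
  exists [::]; split=> //=; rewrite expr0 mulr1 -sum1_card natr_sum.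
  by apply: ler_sum => x _ /=.
pose a x := (1 + eta) ^+ count (fun e : {set A} => x \in e) es.
have a0 x : 0 <= a x by rewrite exprn_ge0 // addr_ge0 // ltW.
have [e eE le] := cov a a0; exists (e :: es); split.
- by rewrite /= szes.
- by move=> e'; rewrite inE => /predU1P[-> //|/esE].
have -> : \sum_x (1 + eta) ^+ count (fun e : {set A} => x \in e) (e :: es) =
    \sum_x a x + eta * (\sum_(x in e) a x).
  rewrite mulr_sumr [\sum_(x in e) _]big_mkcond -big_split /=; apply: eq_bigr => x _.
  by case: (x \in e); rewrite /= ?exprS ?add0n ?addr0 // mulrDl mul1r.
rewrite exprS mulrCA; apply: (@le_trans _ _ ((1 + eta / nu) * (\sum_x a x))).
  rewrite mulrDl mul1r lerD2l -mulrA ler_pM2l // mulrC ler_pdivlMr //.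
  by rewrite mulrC.
by rewrite ler_wpM2l // addr_ge0 // divr_ge0 // ltW.
Qed.

Lemma bernoulli (R : realFieldType) (x : R) n : 0 <= x -> 1 + n%:R * x <= (1 + x) ^+ n.
Proof.
move=> x0; elim: n => [|n IH]; first by rewrite mul0r addr0 expr0.
rewrite exprS; apply: (@le_trans _ _ ((1 + x) * (1 + n%:R * x))).
  have : 0 <= n%:R * x * x by rewrite !mulr_ge0.
  rewrite -natr1; lra.
by rewrite ler_wpM2l // addr_ge0.
Qed.

Lemma exp_inv_bound (R : realFieldType) (x : R) n : 0 <= x -> n%:R * x < 1 ->
  (1 + x) ^+ n <= (1 - n%:R * x)^-1.
Proof.
move=> x0; elim: n => [|n IH] nx; first by rewrite expr0 mul0r subr0 invr1.
have nx' : n%:R * x < 1 by move: nx; rewrite -natr1; lra.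
rewrite exprS -[leRHS]mul1r ler_pdivlMr ?subr_gt0 //.
have := IH nx'; rewrite -[leRHS]mul1r ler_pdivlMr ?subr_gt0 // => le1.
have y0 : 0 <= (1 + x) ^+ n by rewrite exprn_ge0 // addr_ge0.
apply: le_trans le1; rewrite mulrC mulrA mulrC ler_wpM2l //.
have : 0 <= n%:R * x * x by rewrite !mulr_ge0.
by rewrite -natr1; nra.
Qed.

(** After K D + 1 rounds a vertex on more than D edges would alone weigh at least (1 + eta)^(D+1).
    The gap between K and nu keeps the total below this once (1 + eta^3)^D exceeds the number of
    vertices. *)
Lemma fractional_matching (R : realFieldType) (A : finType) (E : {set {set A}}) (nu eta : R) (K D : nat) :
  0 < eta -> eta < 1 -> 1 <= nu -> K%:R <= (1 - eta) * nu ->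
  #|A|%:R < (1 + eta ^+ 3) ^+ D ->
  (forall a : A -> R, (forall x, 0 <= a x) ->
     exists2 e, e \in E & nu * (\sum_(x in e) a x) <= \sum_x a x) ->
  exists es : seq {set A}, [/\ size es = (K * D).+1, {subset es <= E} &
    forall x, (count (fun e : {set A} => x \in e) es <= D)%N].
Proof.
move=> eta0 eta1 nu1 leK bigD cov.
have nu0 : 0 < nu by lra.
have [es [szes esE pot]] := weights_potential (K * D).+1 nu0 eta0 cov.
exists es; split=> // x; rewrite leqNgt; apply/negP => lt.
have e1 : 1 <= 1 + eta by lra.
have en0 : 0 <= eta / nu by rewrite divr_ge0 ?ltW.
have en1 : eta / nu <= eta by rewrite ler_pdivrMr // ler_peMr // ltW.
have leP : (1 + eta) ^+ D.+1 <= #|A|%:R * (1 + eta / nu) ^+ (K * D).+1.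
  apply: le_trans pot; rewrite (bigD1 x) //=.
  rewrite -[leLHS]addr0 lerD ?ler_weXn2l //.
  by apply: sumr_ge0 => y _; rewrite exprn_ge0 //; lra.
(* Uses (1 + x)^K <= 1/(1 - K x) for x = eta/nu, where K x <= (1 - eta) eta. The cube comes from (1
   + eta)(1 - eta + eta^2) = 1 + eta^3. *)
have leK' : (1 + eta / nu) ^+ K * (1 + eta ^+ 3) <= 1 + eta.
  have q1 : K%:R * (eta / nu) <= (1 - eta) * eta.
    rewrite mulrCA mulrC -ler_pdivlMr // mulrK ?unitfE ?gt_eqF //.
    by rewrite ler_pdivrMr.
  have q2 : (1 - eta) * eta < 1 by nra.
  have q3 : 0 < 1 - (1 - eta) * eta by lra.
  apply: (@le_trans _ _ ((1 - (1 - eta) * eta)^-1 * (1 + eta ^+ 3))).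
    rewrite ler_wpM2r //; first by rewrite addr_ge0 // exprn_ge0 // ltW.
    apply: le_trans (exp_inv_bound en0 _) _; first by lra.
    by rewrite lef_pV2 ?posrE; lra.
  rewrite mulrC ler_pdivrMr // le_eqVlt; apply/orP; left; apply/eqP; ring.
have e0 : 0 < 1 + eta by lra.
have e3 : 0 <= 1 + eta ^+ 3 by rewrite addr_ge0 // exprn_ge0 // ltW.
(* The K D rounds form D blocks of K; the one extra round costs a factor of at most 1 + eta, as nu
   >= 1. *)
have : (1 + eta) ^+ D.+1 * (1 + eta ^+ 3) ^+ D <= #|A|%:R * (1 + eta) ^+ D.+1.
  apply: (@le_trans _ _ (#|A|%:R * (1 + eta / nu) * (((1 + eta / nu) ^+ K * (1 + eta ^+ 3)) ^+ D))).
    rewrite exprMn -exprM mulrA ler_wpM2r ?exprn_ge0 //.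
    by rewrite -mulrA -exprS.
  rewrite [(1 + eta) ^+ D.+1]exprS -!mulrA ler_wpM2l //; apply: ler_pM.
  - by rewrite addr_ge0.
  - by rewrite exprn_ge0 // mulr_ge0 // exprn_ge0 // addr_ge0.
  - by rewrite lerD2l.
  - apply: lerXn2r leK'; rewrite nnegrE ?(ltW e0) //.
    by rewrite mulr_ge0 // exprn_ge0 // addr_ge0.
by rewrite leNgt [ltRHS]mulrC ltr_pM2r ?exprn_gt0 // bigD.
Qed.

(** * Cheap edges *)

(** Here g lists the weights on V in increasing order, continued by 0. Among the s + 1 lightest
    elements one avoids any s forbidden ones. *)
Lemma quantile (R : realFieldType) (P : finType) (V : {set P}) (a : P -> R) : (forall p, 0 <= a p) ->
  exists g : nat -> R,
  [/\ forall s (X : {set P}), (#|X| <= s)%N -> (s < #|V|)%N ->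
        exists p, [/\ p \in V, p \notin X & a p <= g s],
      forall s s', (s <= s')%N -> (s' < #|V|)%N -> g s <= g s',
      forall s, 0 <= g s &
      \sum_(p in V) a p = \sum_(0 <= s < #|V|) g s].
Proof.
move=> a0; pose leT p q := a p <= a q.
have leTt : transitive leT by move=> ? ? ?; apply: le_trans.
have leTr : reflexive leT by move=> ?; apply: lexx.
pose l := sort leT (enum V).
have szl : size l = #|V| by rewrite size_sort -cardE.
have sl : sorted leT l by apply: sort_sorted => p q; apply: le_total.
have meml p : (p \in l) = (p \in V) by rewrite mem_sort mem_enum.
have ul : uniq l by rewrite sort_uniq enum_uniq.
pose g s := nth 0 (map a l) s.
have gE p0 s : (s < #|V|)%N -> g s = a (nth p0 l s).
  by move=> sV; rewrite /g (nth_map p0) ?szl.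
have mono s s' : (s <= s')%N -> (s' < #|V|)%N -> g s <= g s'.
  move=> ss' s'V; have sV := leq_ltn_trans ss' s'V.
  have [|p0 _] := card_gt0P (_ : 0 < #|V|)%N; first by lia.
  rewrite !(gE p0) //; apply: (sorted_leq_nth leTt leTr p0 sl) => //.
  - by rewrite inE szl.
  - by rewrite inE szl.
exists g; split=> //.
- move=> s X Xs sV.
  have /subsetPn [p pl pX] : ~~ ([set p in take s.+1 l] \subset X).
    apply/negP => /subset_leq_card; rewrite cardsE.
    have /card_uniqP -> := take_uniq s.+1 ul.
    by rewrite size_take szl; case: ifP; lia.
  have pt : p \in take s.+1 l by rewrite inE in pl.
  exists p; split=> //; first by rewrite -meml (mem_take pt).
  have ip : (index p l <= s)%N.
    by have := pt; rewrite in_take ?(mem_take pt).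
  by have := mono _ _ ip sV; rewrite (gE p) ?nth_index //; [apply: mem_take pt | lia].
- move=> s; rewrite /g; case: (ltnP s (size l)) => sV; last by rewrite nth_default ?size_map.
  have [|p0 _] := card_gt0P (_ : 0 < #|V|)%N; first by lia.
  by rewrite (nth_map p0).
- rewrite -big_enum /=.
  have <- : \sum_(p <- l) a p = \sum_(p <- enum V) a p.
    by apply: perm_big; rewrite perm_sort.
  by rewrite -(big_map a xpredT id) (big_nth 0) size_map szl.
Qed.

Lemma blocks_fit (s : nat -> nat) (L k m : nat) :
  (forall j, (j.+1 < k)%N -> (s j + L <= s j.+1)%N) -> (s k.-1 + L <= m)%N ->
  forall j, (j < k)%N -> (s j + L <= m)%N.
Proof.
move=> sL sm j jk; suff : (s (k.-1 - (k.-1 - j)) <= s k.-1)%N by rewrite subKn; lia.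
have : (k.-1 - j < k)%N by lia.
elim: (k.-1 - j)%N => [|d IH] dk; first by rewrite subn0.
apply: leq_trans (IH _); last by lia.
have -> : (k.-1 - d = (k.-1 - d.+1).+1)%N by lia.
by have := sL (k.-1 - d.+1)%N; lia.
Qed.

(** The intervals [s l, s l + L) are disjoint and lie in [0, m), and by monotonicity g is at least g
    (s l) on the l-th of them. *)
Lemma block_sum (R : realFieldType) (g : nat -> R) (s : nat -> nat) (L k m : nat) : (0 < k)%N ->
  (forall u, 0 <= g u) ->
  (forall u v, (u <= v)%N -> (v < m)%N -> g u <= g v) ->
  (forall j, (j.+1 < k)%N -> (s j + L <= s j.+1)%N) -> (s k.-1 + L <= m)%N ->
  L%:R * (\sum_(l < k) g (s l)) <= \sum_(0 <= u < m) g u.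
Proof.
move=> k0 g0 mono sL.
have block u v : (u + L <= v)%N -> (v <= m)%N ->
    \sum_(0 <= i < u) g i + L%:R * g u <= \sum_(0 <= i < v) g i.
  move=> uv vm; rewrite (@big_cat_nat _ _ _ u 0 v) //=; last by lia.
  rewrite lerD2l (@big_cat_nat _ _ _ (u + L) u v) //=; last by lia.
  rewrite -[leLHS]addr0 lerD ?sumr_ge0 //.
  rewrite -{1}[L](addKn u) mulr_natl -sumr_const_nat.
  by apply: ler_sum_nat => i /andP[? ?]; apply: mono; lia.
move=> sm; have small := blocks_fit sL sm.
have main j : (j < k)%N ->
    L%:R * (\sum_(l < j.+1) g (s l)) <= \sum_(0 <= u < s j + L) g u.
  elim: j => [|j IH] jk.
    rewrite big_ord1; apply: le_trans (block _ _ (leqnn _) (small _ jk)).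
    by rewrite lerDr sumr_ge0.
  rewrite big_ord_recr /= mulrDr; apply: le_trans (block _ _ (leqnn _) (small _ jk)).
  rewrite lerD2r; apply: le_trans (IH (ltnW jk)) _.
  rewrite [leRHS](@big_cat_nat _ _ _ (s j + L)) ?sL //=.
  by rewrite lerDl sumr_ge0.
have := main k.-1; rewrite prednK // => /(_ _)/le_trans; apply; first by lia.
by rewrite [leRHS](@big_cat_nat _ _ _ (s k.-1 + L)) //= lerDl sumr_ge0.
Qed.

(* Starting from part i0 and extending greedily through the parts i0, i0 + 1, ...,
   the j-th vertex can be chosen of weight at most the (s j)-th quantile of its
   part; summing over i0 uses each quantile of each part exactly once. *)
Lemma cheap_edge (R : realFieldType) (P : finType) (r k L : nat) (V : 'I_r.+1 -> {set P})
    (G : pred {set P * 'I_r.+1}) (s : nat -> nat) :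
  (0 < k)%N -> (k <= r.+1)%N -> (0 < L)%N -> G set0 ->
  (forall e i, G e -> (#|e| < k)%N -> (forall x, x \in e -> x.2 != i) ->
     (#|[set p in V i | ~~ G ((p, i) |: e)]| <= s #|e|)%N) ->
  (forall j, (j.+1 < k)%N -> (s j + L <= s j.+1)%N) ->
  (forall i, (s k.-1 + L <= #|V i|)%N) ->
  forall a : P * 'I_r.+1 -> R, (forall x, 0 <= a x) ->
  exists e, [/\ G e, #|e| = k & (r.+1 * L)%:R * (\sum_(x in e) a x) <= \sum_x a x].
Proof.
move=> k0 kr L0 G0 ext sL sV a a0.
have [g gP] := fin_all_exists (fun i => quantile (V i) (fun p => a0 (p, i))).
have sV' j i : (j < k)%N -> (s j < #|V i|)%N.
  by move=> jk; have := blocks_fit sL (sV i) jk; lia.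
(* Addition in ['I_r.+1] is modulo r + 1, so the parts i0 + l with l < k <= r + 1 are distinct and
   the greedy edge never returns to a part. *)
have build (i0 : 'I_r.+1) j : (j <= k)%N -> exists e : {set P * 'I_r.+1},
    [/\ G e, #|e| = j, forall x, x \in e -> exists2 l, (l < j)%N & x.2 = i0 + inord l &
     \sum_(x in e) a x <= \sum_(l < j) g (i0 + inord l) (s l)].
  elim: j => [|j IH] jk.
    exists set0; split; rewrite ?cards0 // ?big_set0 ?big_ord0 //.
    by move=> x; rewrite inE.
  have [e [Ge ce es ea]] := IH (ltnW jk).
  pose i := i0 + inord j.
  have ei x : x \in e -> x.2 != i.
    move=> /es [l lj ->]; apply/negP => /eqP /addrI /(congr1 val) /=.
    by rewrite !inordK; lia.
  have := ext e i Ge; rewrite ce => /(_ jk ei) bad.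
  have [gp _ _ _] := gP i.
  have [p [pV pX pa]] := gp _ _ bad (sV' _ i jk).
  have Gp : G ((p, i) |: e) by move: pX; rewrite inE pV /= negbK.
  have pe : (p, i) \notin e by apply/negP => /ei; rewrite eqxx.
  exists ((p, i) |: e); split=> //.
  - by rewrite cardsU1 pe ce.
  - move=> x; rewrite in_setU1 => /predU1P[-> |/es [l lj ->]]; first by exists j.
    by exists l => //; lia.
  - by rewrite big_setU1 //= big_ord_recr /= addrC lerD.
have [E EP] := fin_all_exists (fun i0 => build i0 k (leqnn k)).
case: (pickP [pred i0 | (r.+1 * L)%:R * (\sum_(x in E i0) a x) <= \sum_x a x]) => [i0 /= le|none].
  by exists (E i0); have [? ? _ _] := EP i0.
have lt i0 : \sum_x a x < (r.+1 * L)%:R * (\sum_(x in E i0) a x).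
  by have := none i0; rewrite /= ltNge => ->.
have : r.+1%:R * (\sum_x a x) < r.+1%:R * (L%:R * \sum_i0 (\sum_(x in E i0) a x)).
  have -> : r.+1%:R * (\sum_x a x) = \sum_(i < r.+1) \sum_x a x.
    by rewrite sumr_const card_ord mulr_natl.
  rewrite mulrA -natrM mulr_sumr.
  by apply: ltr_sum => //; apply/hasP; exists ord0; rewrite ?mem_index_enum.
rewrite ltr_pM2l // ltNge; case/negP.
apply: (@le_trans _ _ (L%:R * \sum_(i0 < r.+1) \sum_(l < k) g (i0 + inord l) (s l))).
  by rewrite ler_wpM2l // ler_sum // => i0 _; have [] := EP i0.
have -> : \sum_(i0 < r.+1) \sum_(l < k) g (i0 + inord l) (s l) =
    \sum_(i < r.+1) \sum_(l < k) g i (s l).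
  rewrite exchange_big [RHS]exchange_big /=; apply: eq_bigr => l _.
  by rewrite [RHS](reindex_inj (addIr (inord l))).
rewrite mulr_sumr; apply: (@le_trans _ _ (\sum_(i < r.+1) \sum_(p in V i) a (p, i))).
  apply: ler_sum => i _; have [_ mono gi0 ->] := gP i.
  exact: block_sum.
have -> : \sum_x a x = \sum_i \sum_p a (p, i).
  by rewrite exchange_big pair_big; apply: eq_bigr => -[].
apply: ler_sum => i _; rewrite big_mkcond /=; apply: ler_sum => p _.
by case: ifP.
Qed.

(** * Sampling *)

Definition agree (N : nat) (C : finType) (Q : {set 'I_N}) (f g : {ffun 'I_N -> C}) :=
  [forall p in Q, f p == g p].

(** Writing agreement on Q as a product of indicators makes the sum factor over coordinates; each
    coordinate in Q contributes 1. *)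
Lemma sum_agree (R : realFieldType) (N : nat) (C : finType) (Q : {set 'I_N}) (g : {ffun 'I_N -> C}) (h : C -> R) :
  \sum_(f | agree Q f g) \prod_(p in ~: Q) h (f p) = (\sum_c h c) ^+ #|~: Q|.
Proof.
pose F p c := if p \in Q then (c == g p)%:R else h c.
transitivity (\sum_(f : {ffun 'I_N -> C}) \prod_p F p (f p)).
  rewrite big_mkcond; apply: eq_bigr => f _; rewrite [RHS](bigID (fun p => p \in Q)) /=.
  have -> : \prod_(p in Q) F p (f p) = (agree Q f g)%:R.
    rewrite (eq_bigr (fun p => (f p == g p)%:R)); last by move=> p pQ; rewrite /F pQ.
    case: (boolP (agree Q f g)) => [/forall_inP ag|].
      by rewrite big1 // => p /ag ->.
    rewrite negb_forall_in => /exists_inP [p pQ ne].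
    by rewrite (bigD1 p) //= (negbTE ne) mul0r.
  case: ifP => _; rewrite ?mul0r // mul1r; apply: eq_big => p.
    by rewrite inE.
  by rewrite inE /F => /negbTE ->.
rewrite -bigA_distr_bigA /= (bigID (fun p => p \in Q)) /= big1 => [|p pQ].
  rewrite mul1r -prodr_const; apply: eq_big => p; first by rewrite inE.
  by move/negbTE => pQ; rewrite /F pQ.
rewrite (bigD1 (g p)) //= big1 => [|c /negbTE cg]; first by rewrite /F pQ eqxx addr0.
by rewrite /F pQ cg.
Qed.

(** The bound 1 - x <= [expR (- x)] gives (1 - x) [expR x] <= 1, while (1 - x)(1 + x + 2 x^2) = 1 +
    x^2 (1 - 2x) >= 1. *)
Lemma expR_quadratic (R : realType) (x : R) : 0 <= x -> x <= 1 / 2 -> expR x <= 1 + x + 2 * x ^+ 2.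
Proof.
move=> x0 x2; have := expR_ge1Dx (- x); rewrite expRN => le.
have y0 : 0 < expR x by apply: expR_gt0.
have : (1 - x) * expR x <= 1 by rewrite -ler_pdivlMr // mul1r.
by nra.
Qed.

(* Chernoff bound in which the target set may depend on the coordinates in Q,
   which are not counted. *)
Lemma chernoff (R : realType) (N : nat) (C : finType) (Q : {set 'I_N})
    (Bad : {ffun 'I_N -> C} -> {set C}) (q eps : R) :
  (0 < #|C|)%N -> 0 < eps -> eps <= 1 -> 0 <= q -> q <= 2 ->
  (forall f g, agree Q f g -> Bad f = Bad g) ->
  (forall f, #|Bad f|%:R <= q * #|C|%:R) ->
  #|[set f : {ffun 'I_N -> C} |
      (q + eps) * N%:R <= #|[set p in ~: Q | f p \in Bad f]|%:R]|%:R
  <= expR (- (N%:R * (eps ^+ 2 / 16))) * (#|C| ^ N)%:R.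
Proof.
move=> C0 e0 e1 q0 q2 badE badq; set S := [set f | _].
(* In the exponent lam eps = eps^2/8 is gained and at most 2 q lam^2 <= eps^2/16 is lost, since q <=
   2. *)
pose lam := eps / 8; pose z := expR lam.
have l0 : 0 < lam by rewrite divr_gt0.
have z1 : 1 <= z by rewrite -expR0 ler_expR ltW.
have zq : z - 1 <= lam + 2 * lam ^+ 2.
  have l2 : lam <= 1 / 2 by rewrite /lam; lra.
  by have := expR_quadratic (ltW l0) l2; rewrite -/z; lra.
pose X (f g : {ffun 'I_N -> C}) := #|[set p in ~: Q | f p \in Bad g]|.
have XE f g : z ^+ X f g = \prod_(p in ~: Q) (if f p \in Bad g then z else 1).
  rewrite /X -big_mkcondr -prodr_const; apply: eq_bigl => p.
  by rewrite !inE.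
set d := #|~: Q|.
have CR : 0 < #|C|%:R :> R by rewrite ltr0n.
have sumz (g : {ffun 'I_N -> C}) :
    \sum_(f | agree Q f g) z ^+ X f g <= (#|C|%:R * (1 + q * (z - 1))) ^+ d.
  rewrite (eq_bigr _ (fun f _ => XE f g)).
  rewrite (sum_agree Q g (fun c => if c \in Bad g then z else 1)).
  have -> : \sum_c (if c \in Bad g then z else 1) = #|C|%:R + #|Bad g|%:R * (z - 1).
    rewrite (eq_bigr (fun c => 1 + (if c \in Bad g then z - 1 else 0))).
      by rewrite big_split /= sumr_const -big_mkcond sumr_const mulr_natl.
    by move=> c _; case: ifP => _; ring.
  have z0 : 0 <= z - 1 by rewrite subr_ge0.
  apply: lerXn2r; rewrite ?nnegrE.
  - by rewrite addr_ge0 ?mulr_ge0.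
  - by rewrite mulr_ge0 // addr_ge0 ?mulr_ge0.
  - by rewrite [leRHS]mulrDr mulr1 lerD2l mulrA ler_wpM2r // mulrC.
(* Instead of conditioning on the coordinates in Q, sum over all pairs f, g agreeing on Q: the
   target set is then fixed by g, and every f is counted |C|^d times. *)
have total : (\sum_f z ^+ X f f) * #|C|%:R ^+ d
    <= (#|C| ^ N)%:R * (#|C|%:R * (1 + q * (z - 1))) ^+ d.
  apply: (@le_trans _ _ (\sum_(g : {ffun 'I_N -> C}) \sum_(f | agree Q f g) z ^+ X f g)).
    rewrite (exchange_big_dep predT) //= mulr_suml le_eqVlt; apply/orP; left; apply/eqP.
    apply: eq_bigr => f _.
    have ag g : agree Q f g = agree Q g f.
      by apply: eq_forallb => p; rewrite eq_sym.
    rewrite (eq_bigr (fun g => z ^+ X f f)); last first.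
      by move=> g fg; rewrite /X (badE _ _ fg).
    have -> : #|C|%:R ^+ d = \sum_(g | agree Q g f) \prod_(p in ~: Q) (1 : R).
      by rewrite (sum_agree Q f (fun _ => 1)) sumr_const.
    rewrite mulr_sumr; apply: eq_big => g; first by rewrite ag.
    by rewrite big1 ?mulr1.
  apply: le_trans (ler_sum _ (fun g _ => sumz g)) _.
  by rewrite sumr_const card_ffun card_ord [leRHS]mulr_natl.
have {}total : \sum_f z ^+ X f f <= (#|C| ^ N)%:R * expR (N%:R * (q * (z - 1))).
  have z0 : 0 <= q * (z - 1) by rewrite mulr_ge0 // subr_ge0.
  move: total; rewrite exprMn mulrCA [leRHS]mulrC ler_pM2r ?exprn_gt0 // => /le_trans; apply.
  rewrite ler_wpM2l // expRM_natl.
  apply: (@le_trans _ _ ((1 + q * (z - 1)) ^+ N)).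
    by apply: ler_weXn2l; [lra | rewrite -[N]card_ord max_card].
  by apply: lerXn2r; rewrite ?nnegrE ?expR_ge0 ?expR_ge1Dx //; lra.
have low : #|S|%:R * expR (lam * ((q + eps) * N%:R)) <= \sum_f z ^+ X f f.
  rewrite -sum1_card natr_sum mulr_suml big_mkcond; apply: ler_sum => f _.
  case: ifP => [|_]; last by rewrite exprn_ge0 // expR_ge0.
  by rewrite inE mul1r -expRM_natl ler_expR => le; rewrite [leLHS]mulrC ler_pM2r.
rewrite -(ler_pM2r (expR_gt0 (lam * ((q + eps) * N%:R)))).
apply: le_trans low (le_trans total _).
rewrite [leRHS]mulrAC -expRD [leLHS]mulrC ler_wpM2r // ler_expR.
have N0 : 0 <= N%:R :> R by [].
have : q * (z - 1) <= lam * (q + eps) - eps ^+ 2 / 16.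
  apply: (@le_trans _ _ (q * (lam + 2 * lam ^+ 2))); first by rewrite ler_wpM2l.
  rewrite /lam; nra.
move/(ler_wpM2l N0); lra.
Qed.

(** * Templates and augmentation *)

(* The fibres of own are the cells; a template f lists N sampled cells, and (p, i)
   stands for the vertex in part i of the p-th of them. *)
Section Templates.
Variables (T C : finType) (r : nat) (part : T -> 'I_r) (own : T -> C).

Definition cell (c : C) : {set T} := [set v | own v == c].

(** A cell need not meet every part, so the trace can be smaller than e; where this matters its size
    is demanded separately. *)
Definition trace (N : nat) (f : {ffun 'I_N -> C}) (e : {set 'I_N * 'I_r}) : {set T} :=
  [set v | [exists x in e, (own v == f x.1) && (part v == x.2)]].

(** Injectivity of [fst] puts the vertices at distinct positions, so that in a blow-up the copy of
    each can be chosen independently. *)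
Definition template_edges (N k : nat) (J : {set {set T}}) (f : {ffun 'I_N -> C}) :
    {set {set 'I_N * 'I_r}} :=
  [set e : {set 'I_N * 'I_r} |
    [&& #|e| == k, dinjectiveb fst e & trace f e \in layer J k]].

Lemma traceP (N : nat) (f : {ffun 'I_N -> C}) (e : {set 'I_N * 'I_r}) v :
  reflect (exists x, [/\ x \in e, own v = f x.1 & part v = x.2]) (v \in trace f e).
Proof.
rewrite inE; apply: (iffP exists_inP) => [[x xe /andP[/eqP ? /eqP ?]]|[x [xe -> ->]]].
  by exists x.
by exists x; rewrite // !eqxx.
Qed.

(* A family es of template edges using every template vertex at most D times
   becomes a matching in the D-fold blow-up: the s-th edge uses the copy of a
   vertex x numbered by the edges before s that contain x. *)
Lemma augment (k N D : nat) (J : {set {set T}}) (Mc : {set C})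
    (E : {set {set 'I_N * 'I_r}}) (Ks : {set 'I_N}) (b : 'I_N -> 'I_D.+1 -> C)
    (es : seq {set 'I_N * 'I_r}) :
  (0 < k)%N -> (forall c, c \in Mc -> cell c \in layer J k) ->
  (forall p q p' q', b p q = b p' q' -> p = p' /\ q = q') ->
  (forall phi : 'I_N -> 'I_D.+1, let f := [ffun p => b p (phi p)] in
     template_edges k J f = E /\ [set p | f p \in Mc] = Ks) ->
  size es = (#|Ks| * D.+1).+1 -> {subset es <= E} ->
  (forall x, (count (fun e : {set 'I_N * 'I_r} => x \in e) es <= D.+1)%N) ->
  exists M : {set {set T}}, [/\ M \subset layer J k, matching M & (#|Mc| < #|M|)%N].
Proof.
move=> k0 McJ bI type szes esE esD; pose t := size es.
pose e s := nth set0 es s.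
pose cnt s x := count (fun e : {set 'I_N * 'I_r} => x \in e) (take s es).
(* Edge s has at most one vertex over p, so this is the number of earlier edges through that vertex,
   or 0 if there is none. *)
pose rk s p := (\sum_(x in e s | x.1 == p) cnt s x)%N.
pose f s : {ffun 'I_N -> C} := [ffun p => b p (inord (rk s p))].
pose ne s := trace (f s) (e s).
have eE s : (s < t)%N -> e s \in E by move=> st; apply/esE/mem_nth.
have eT s : (s < t)%N -> e s \in template_edges k J (f s).
  by move=> st; have [-> _] := type (fun p => inord (rk s p)); apply: eE.
have cntS s x : (s < t)%N -> cnt s.+1 x = (cnt s x + (x \in e s))%N.
  by move=> st; rewrite /cnt (take_nth set0 st) -cats1 count_cat /= addn0.
have cnt_mono s s' x : (s <= s')%N -> (cnt s x <= cnt s' x)%N.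
  move=> ss'; rewrite /cnt -(cat_take_drop s (take s' es)) count_cat take_takel //.
  exact: leq_addr.
have cntD s x : (cnt s x <= D.+1)%N.
  apply: leq_trans (esD x); rewrite -[X in count _ X](cat_take_drop s es) count_cat.
  exact: leq_addr.
have rkE s x : (s < t)%N -> x \in e s -> rk s x.1 = cnt s x.
  move=> st xe; have := eT s st; rewrite inE => /and3P[_ /dinjectiveP inj _].
  rewrite /rk (bigD1 x) ?xe ?eqxx //= big1 ?addn0 // => y /andP[/andP[ye /eqP yx]].
  by rewrite (inj y x ye xe yx) eqxx.
have neP s v : (s < t)%N -> v \in ne s ->
    exists x, [/\ x \in e s, own v = b x.1 (inord (cnt s x)), part v = x.2 & (cnt s x < D.+1)%N].
  move=> st /traceP [x [xe ov pv]]; exists x; split=> //.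
    by rewrite ov ffunE rkE.
  by apply: leq_trans (cntD s.+1 x); rewrite cntS // xe addn1.
have neJ s : (s < t)%N -> ne s \in layer J k by move=> /eT; rewrite inE => /and3P[].
have layer_gt0 g : g \in layer J k -> exists v, v \in g.
  by rewrite inE => /andP[_ /eqP gk]; apply/card_gt0P; rewrite gk.
(* A common vertex would come from the same template vertex x with the same copy number in both
   edges, but edge s itself raises the count of x. *)
have ne_lt s s' v : (s < s')%N -> (s' < t)%N -> v \in ne s -> v \in ne s' -> False.
  move=> ss' s't; have st := ltn_trans ss' s't.
  move=> /(neP _ _ st) [x [xe ox px xD]] /(neP _ _ s't) [y [ye oy py yD]].
  move: ox; rewrite oy => /bI [yx1 /(congr1 val)]; rewrite /= !inordK // => cyx.
  have xy : y = x by rewrite [y]surjective_pairing [x]surjective_pairing yx1 -py -px.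
  have := cnt_mono _ _ x ss'; rewrite cntS // xe -cyx xy; lia.
have ne_eq s s' v : (s < t)%N -> (s' < t)%N -> v \in ne s -> v \in ne s' -> s = s'.
  move=> st s't vs vs'; case: (ltngtP s s') => // lt; exfalso.
    exact: ne_lt lt s't vs vs'.
  exact: ne_lt lt st vs' vs.
have KsP p q : b p q \in Mc -> p \in Ks.
  by have [_ <-] := type (fun _ => q); rewrite inE ffunE.
(* B holds every copy of the matched positions. Only matching edges in B can meet new edges, and B
   has at most [#|Ks| * D.+1] elements, one fewer than there are new edges. *)
pose B := [set b x.1 x.2 | x in setX Ks [set: 'I_D.+1]].
have ne_cell s c v : (s < t)%N -> c \in Mc :\: B -> v \in ne s -> v \in cell c -> False.
  move=> st /setDP[cM cB] /(neP _ _ st) [x [_ ov _ _]]; rewrite inE ov => /eqP bc.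
  case/negP: cB; apply/imsetP; exists (x.1, inord (cnt s x)) => //.
  by rewrite !inE andbT (@KsP _ (inord (cnt s x))) // bc.
pose M1 := cell @: (Mc :\: B); pose M2 := [set ne (nat_of_ord s) | s : 'I_t].
have M1J g : g \in M1 -> g \in layer J k by case/imsetP => c /setDP[/McJ ? _] ->.
have M2J g : g \in M2 -> g \in layer J k by case/imsetP => s _ ->; apply: neJ.
have M12 g g' v : g \in M1 -> g' \in M2 -> v \in g -> v \in g' -> False.
  move=> /imsetP [c cM ->] /imsetP [s _ ->] vc vs; exact: ne_cell _ cM vs vc.
exists (M1 :|: M2); split.
- by apply/subsetP => g /setUP[/M1J|/M2J].
- move=> g g' gM g'M gg'; rewrite -setI_eq0; apply/set0Pn => -[v /setIP[vg vg']].
  case/setUP: gM => gM; case/setUP: g'M => g'M.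
  + case/imsetP: gM vg gg' => c _ ->; case/imsetP: g'M vg' => c' _ ->.
    by rewrite !inE => /eqP -> /eqP ->; rewrite eqxx.
  + exact: M12 gM g'M vg vg'.
  + exact: M12 g'M gM vg' vg.
  + case/imsetP: gM vg gg' => s _ ->; case/imsetP: g'M vg' => s' _ -> vs' vs.
    by rewrite (ne_eq s s' v) ?eqxx.
- have c1 : #|M1| = #|Mc :\: B|.
    apply: card_in_imset => c c' /setDP[/McJ/layer_gt0 [v vc] _] _ cc'.
    by have := vc; rewrite cc'; move: vc; rewrite !inE => /eqP <- /eqP <-.
  have c2 : #|M2| = t.
    rewrite card_imset ?card_ord // => s s' ss'.
    have [v vs] := layer_gt0 _ (neJ s (ltn_ord s)).
    by apply/val_inj/(ne_eq s s' v) => //; rewrite -ss'.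
  have dis : M1 :&: M2 = set0.
    apply/setP => g; rewrite !inE; apply/negP => /andP[g1 g2].
    by have [v vg] := layer_gt0 _ (M1J _ g1); case: (M12 _ _ _ g1 g2 vg vg).
  rewrite cardsU dis cards0 subn0 c1 c2 /t szes cardsD.
  have : (#|B| <= #|Ks| * D.+1)%N.
    by apply: leq_trans (leq_imset_card _ _) _; rewrite cardsX cardsT card_ord.
  have := subset_leq_card (subsetIr Mc B); lia.
Qed.
End Templates.

(** * Random templates inheriting the degree conditions *)

Lemma card_small_sets (A : finType) (k : nat) :
  (#|[set e : {set A} | (#|e| < k)%N]| <= #|A|.+1 ^ k)%N.
Proof.
(* A set of fewer than k elements is the range of a list padded with [None]. *)
pose F (h : {ffun 'I_k -> option A}) := [set x | [exists i, h i == Some x]].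
apply: (@leq_trans #|F @: [set: {ffun 'I_k -> option A}]|); last first.
  by apply: leq_trans (leq_imset_card _ _) _; rewrite cardsT card_ffun card_ord card_option.
apply/subset_leq_card/subsetP => e; rewrite inE => ek.
apply/imsetP; exists [ffun i : 'I_k => nth None (map Some (enum e)) i]; first by rewrite inE.
apply/setP => x; rewrite inE; apply/idP/existsP => [xe|[i]].
  have ix : (index x (enum e) < #|e|)%N by rewrite cardE index_mem mem_enum.
  exists (Ordinal (ltn_trans ix ek)); rewrite ffunE /= (nth_map x) -?cardE //.
  by rewrite nth_index ?mem_enum.
rewrite ffunE => /eqP h.
have ie : (i < size (enum e))%N.
  rewrite ltnNge; apply/negP => le; move: h.
  by rewrite nth_default // size_map.
have : Some x \in map Some (enum e) by rewrite -h mem_nth // size_map.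
by rewrite mem_map ?mem_enum // => ? ? [].
Qed.

Lemma union_bound (R : realFieldType) (I Z : finType) (S : {set I}) (G : I -> {set Z}) (beta : R) :
  (forall i, i \in S -> #|G i|%:R <= beta) ->
  #|\bigcup_(i in S) G i|%:R <= #|S|%:R * beta.
Proof.
move=> le; apply: (@le_trans _ _ (\sum_(i in S) #|G i|)%:R).
  by rewrite ler_nat card_bigcup_le.
by rewrite natr_sum mulr_natl -sumr_const ler_sum.
Qed.

(** The exponential of N c is the (k+1)-st power of that of N c / (k+1), hence at least (N c /
    (k+1))^(k+1). This has degree k + 1 in N and so beats 2 B N^k. *)
Lemma poly_exp_small (R : realType) (B c : R) (k : nat) : 0 < c -> exists N0, forall N, (N0 <= N)%N ->
  B * N%:R ^+ k * expR (- (N%:R * c)) <= 1 / 2.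
Proof.
move=> c0; pose d := (c / k.+1%:R) ^+ k.+1.
have d0 : 0 < d by rewrite exprn_gt0 // divr_gt0.
exists (Num.bound (`|2 * B| / d)) => N leN.
have leB : 2 * B <= N%:R * d.
  apply: le_trans (ler_norm _) _; rewrite -ler_pdivrMr //.
  apply: le_trans (ltW (archi_boundP _)) _; last by rewrite ler_nat.
  by rewrite divr_ge0 // ltW.
rewrite expRN ler_pdivrMr ?expR_gt0 //.
have : 2 * B * N%:R ^+ k <= expR (N%:R * c); last by lra.
apply: (@le_trans _ _ ((N%:R * (c / k.+1%:R)) ^+ k.+1)).
  by rewrite exprMn -/d exprSr -[leRHS]mulrA [leLHS]mulrC ler_wpM2l ?exprn_ge0.
have -> : N%:R * c = k.+1%:R * (N%:R * (c / k.+1%:R)).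
  by rewrite mulrCA [k.+1%:R * _]mulrC divfK ?pnatr_eq0.
rewrite expRM_natl; apply: lerXn2r; rewrite ?nnegrE ?expR_ge0 //.
  by rewrite mulr_ge0 // divr_ge0 // ltW.
by apply: le_trans (expR_ge1Dx _); rewrite lerDr.
Qed.

Section Sampling.
Variables (R : realType) (T C : finType) (r : nat) (part : T -> 'I_r.+1) (own : T -> C).
Variables (J : {set {set T}}) (k n : nat) (alpha : R).
Hypothesis own_inj : forall u v, part u = part v -> own u = own v -> u = v.
Hypothesis card_part : forall i, #|Vpart part i| = n.
Hypothesis alpha0 : 0 <= alpha.
Hypothesis alpha1 : alpha <= 1.
Hypothesis degJ : forall e i, e \in J -> (#|e| < k)%N -> [disjoint e & Vpart part i] ->
  ((k - #|e|)%:R / k%:R - alpha) * n%:R <= #|ext_nbhd part J e i|%:R.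

Definition hits (i : 'I_r.+1) : {set C} := own @: Vpart part i.

Lemma card_hits i : #|hits i| = n.
Proof.
rewrite -(card_part i); apply: card_in_imset => u v.
by rewrite !inE => /eqP pu /eqP pv; apply: own_inj; rewrite pu pv.
Qed.

Definition positions (N : nat) (f : {ffun 'I_N -> C}) i : {set 'I_N} :=
  [set p | f p \in hits i].

(** The predicate extended greedily in [cheap_edge]; unlike [template_edges] it admits partial
    edges. *)
Definition faithful (N : nat) (f : {ffun 'I_N -> C}) (e : {set 'I_N * 'I_r.+1}) : bool :=
  [&& dinjectiveb fst e, trace part own f e \in J & #|trace part own f e| == #|e|].

(** The default [set0] makes the bound of [card_blocked] hold for every f, as [chernoff] requires.
    The value depends on f only at the positions of e. *)
Definition blocked (N : nat) (e : {set 'I_N * 'I_r.+1}) i (f : {ffun 'I_N -> C}) : {set C} :=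
  if (trace part own f e \in J) && (#|trace part own f e| == #|e|) then
    own @: (Vpart part i :\: ext_nbhd part J (trace part own f e) i)
  else set0.

Lemma disjoint_trace (N : nat) (f : {ffun 'I_N -> C}) (e : {set 'I_N * 'I_r.+1}) i :
  (forall x, x \in e -> x.2 != i) -> [disjoint trace part own f e & Vpart part i].
Proof.
move=> ei; rewrite -setI_eq0; apply/set0Pn => -[v /setIP[/traceP [x [xe _ px]]]].
by rewrite inE px; apply/negP/ei.
Qed.

Lemma trace_agree (N : nat) (f g : {ffun 'I_N -> C}) (e : {set 'I_N * 'I_r.+1}) :
  agree (fst @: e) f g -> trace part own f e = trace part own g e.
Proof.
move=> /forall_inP fg; apply/setP => v; rewrite !inE; apply: eq_existsb => x.
by case xe: (x \in e) => //=; rewrite (eqP (fg x.1 _)) // imset_f.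
Qed.

Lemma card_blocked (N : nat) (e : {set 'I_N * 'I_r.+1}) i (f : {ffun 'I_N -> C}) :
  (#|e| < k)%N -> (forall x, x \in e -> x.2 != i) ->
  #|blocked e i f|%:R <= (#|e|%:R / k%:R + alpha) * n%:R.
Proof.
move=> ek ei; have k0 : 0 < k%:R :> R by rewrite ltr0n; lia.
rewrite /blocked; case: ifP => [/andP[tJ /eqP te]|_]; last first.
  by rewrite cards0 mulr_ge0 // addr_ge0 // divr_ge0.
have := degJ tJ _ (disjoint_trace f ei); rewrite te => /(_ ek).
have -> : (k - #|e|)%:R / k%:R = 1 - #|e|%:R / k%:R :> R.
  by rewrite natrB ?(ltnW ek) // mulrBl divff ?gt_eqF.
set X := ext_nbhd _ _ _ _ => deg.
apply: (@le_trans _ _ (#|Vpart part i :\: X|)%:R); first by rewrite ler_nat leq_imset_card.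
have XV : X \subset Vpart part i by apply/subsetP => v; rewrite inE => /andP[].
have := cardsD (Vpart part i) X; rewrite (setIidPr XV) card_part => ->.
by rewrite natrB -?(card_part i) ?subset_leq_card // card_part; lra.
Qed.

Lemma trace_setU1 (N : nat) (f : {ffun 'I_N -> C}) (e : {set 'I_N * 'I_r.+1}) v p i :
  part v = i -> own v = f p ->
  trace part own f ((p, i) |: e) = v |: trace part own f e.
Proof.
move=> pv ov; apply/setP => u; apply/traceP/setU1P => [[x [/setU1P[->|xe] ou pu]]|].
- by left; apply: own_inj; [rewrite pu pv | rewrite ou ov].
- by right; apply/traceP; exists x.
case=> [->|/traceP [x [xe ou pu]]]; first by exists (p, i); rewrite setU11.
by exists x; rewrite setU1r.
Qed.

(** A position with a vertex in part i can fail in two ways: e already uses it, which happens at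
    most [#|e|] times, or its vertex in part i does not extend the trace. *)
Lemma faithful_ext (N : nat) (f : {ffun 'I_N -> C}) (e : {set 'I_N * 'I_r.+1}) i :
  faithful f e -> (forall x, x \in e -> x.2 != i) ->
  [set p in positions f i | ~~ faithful f ((p, i) |: e)] \subset
  (fst @: e) :|: [set p in ~: (fst @: e) | f p \in blocked e i f].
Proof.
move=> /and3P[/dinjectiveP inj tJ te] ei; apply/subsetP => p.
rewrite !inE => /andP[/imsetP [v]]; rewrite inE => /eqP pv fp nf.
case: (boolP (p \in fst @: e)) => //= pe; rewrite /blocked tJ te /= fp.
apply/imset_f; rewrite !inE pv eqxx andbT /=.
apply: contraNN nf => vJ; rewrite /faithful (trace_setU1 e pv (esym fp)) vJ /=.
have vt : v \notin trace part own f e.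
  by apply/negP => /traceP [x [/ei/negP xi _ pvx]]; apply: xi; rewrite -pvx pv.
have pie : (p, i) \notin e by apply: contraNN pe => pie; apply/imsetP; exists (p, i).
rewrite !cardsU1 vt pie (eqP te) eqxx andbT.
apply/dinjectiveP => x y /setU1P[->|xe] /setU1P[->|ye] //=.
- by move=> py; case/negP: pe; rewrite py imset_f.
- by move=> px; case/negP: pe; rewrite -px imset_f.
- exact: inj.
Qed.

(** A template is discarded if some pair (e, i) has too many blocked positions ([S1]), some part is
    hit too rarely ([S2]) or too many cells are matched ([S3]). Each event has exponentially small
    probability by [chernoff], and their number is polynomial in N. *)
Lemma sampled_templates (N : nat) (eps : R) (Mc : {set C}) :
  (0 < #|C|)%N -> 0 < eps -> eps <= 1 -> (0 < N)%N ->
  3 * r.+1%:R * (2 * r.+1%:R) ^+ k * N%:R ^+ k * expR (- (N%:R * (eps ^+ 2 / 16))) <= 1 / 2 ->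
  let mu : R := n%:R / #|C|%:R in
  exists2 H : {set {ffun 'I_N -> C}}, 1 / 2 * (#|C| ^ N)%:R <= #|H|%:R :> R &
  forall f, f \in H ->
  [/\ forall e i, faithful f e -> (#|e| < k)%N -> (forall x, x \in e -> x.2 != i) ->
        #|[set p in positions f i | ~~ faithful f ((p, i) |: e)]|%:R <=
          k%:R + ((#|e|%:R / k%:R + alpha) * mu + eps) * N%:R,
      forall i, (mu - eps) * N%:R <= #|positions f i|%:R &
      #|[set p | f p \in Mc]|%:R <= (#|Mc|%:R / #|C|%:R + eps) * N%:R].
Proof.
move=> C0 e0 e1 N0 small mu.
have CR : 0 < #|C|%:R :> R by rewrite ltr0n.
have nC : (n <= #|C|)%N by rewrite -(card_hits ord0) max_card.
have mu0 : 0 <= mu by rewrite divr_ge0.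
have mu1 : mu <= 1 by rewrite ler_pdivrMr // mul1r ler_nat.
have muC : mu * #|C|%:R = n%:R by rewrite divfK // gt_eqF.
set beta := expR (- (N%:R * (eps ^+ 2 / 16))) * (#|C| ^ N)%:R.
pose S1 (x : {set 'I_N * 'I_r.+1} * 'I_r.+1) := [set f : {ffun 'I_N -> C} |
  (((#|x.1|%:R / k%:R + alpha) * mu) + eps) * N%:R <=
    #|[set p in ~: (fst @: x.1) | f p \in blocked x.1 x.2 f]|%:R].
pose I1 : {set {set 'I_N * 'I_r.+1} * 'I_r.+1} :=
  [set x : {set 'I_N * 'I_r.+1} * 'I_r.+1 | (#|x.1| < k)%N & [forall y in x.1, y.2 != x.2]].
(* The lower tail for part i is the upper tail for the cells missing it, with q = 1 - mu. *)
pose S2 (i : 'I_r.+1) := [set f : {ffun 'I_N -> C} |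
  (1 - mu + eps) * N%:R <= #|[set p in ~: set0 | f p \in ~: hits i]|%:R].
pose S3 := [set f : {ffun 'I_N -> C} |
  (#|Mc|%:R / #|C|%:R + eps) * N%:R <= #|[set p in ~: set0 | f p \in Mc]|%:R].
have b1 x : x \in I1 -> #|S1 x|%:R <= beta.
  case: x => e i; rewrite inE /= => /andP[ek /forall_inP ei].
  have k0 : 0 < k%:R :> R by rewrite ltr0n; lia.
  have ek1 : #|e|%:R / k%:R <= 1 :> R by rewrite ler_pdivrMr // mul1r ler_nat ltnW.
  have ek0 : 0 <= #|e|%:R / k%:R :> R by rewrite divr_ge0.
  apply: chernoff => //.
  - by rewrite mulr_ge0 // addr_ge0.
  - have le2 (x a m : R) : 0 <= x -> x <= 1 -> 0 <= a -> a <= 1 -> 0 <= m -> m <= 1 -> (x + a) * m <= 2.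
      by nra.
    exact: le2.
  - by move=> f g fg; rewrite /blocked (trace_agree fg).
  - by move=> f; rewrite -mulrA muC card_blocked.
have b2 i : i \in [set: 'I_r.+1] -> #|S2 i|%:R <= beta.
  move=> _; apply: chernoff => //; rewrite ?subr_ge0 //.
  - by lra.
  - by move=> f; rewrite cardsCs setCK card_hits natrB // mulrBl mul1r muC.
have b3 : #|S3|%:R <= beta.
  apply: chernoff => //; rewrite ?divr_ge0 //.
  - rewrite ler_pdivrMr //; have : #|Mc|%:R <= #|C|%:R :> R by rewrite ler_nat max_card.
    by lra.
  - by move=> f; rewrite divfK // gt_eqF.
pose U := \bigcup_(x in I1) S1 x :|: \bigcup_(i in [set: 'I_r.+1]) S2 i :|: S3.
have cI1 : #|I1|%:R <= (2 * r.+1%:R) ^+ k * N%:R ^+ k * r.+1%:R :> R.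
  rewrite -exprMn -!natrM -natrX -natrM ler_nat.
  apply: (@leq_trans #|setX [set e : {set 'I_N * 'I_r.+1} | (#|e| < k)%N] [set: 'I_r.+1]|).
    by apply/subset_leq_card/subsetP => -[e i]; rewrite !inE /= => /andP[-> _].
  rewrite cardsX cardsT card_ord leq_mul2r /=; apply: leq_trans (card_small_sets _ _) _.
  rewrite card_prod !card_ord; case: (posnP k) => [->|k0]; first by rewrite !expn0.
  by rewrite leq_exp2r //; nia.
have cU : #|U|%:R <= 1 / 2 * (#|C| ^ N)%:R :> R.
  have beta0 : 0 <= beta by rewrite mulr_ge0 // expR_ge0.
  apply: (@le_trans _ _ (#|I1|%:R * beta + r.+1%:R * beta + beta)).
    apply: (@le_trans _ _ (#|\bigcup_(x in I1) S1 x|%:R + #|\bigcup_(i in [set: 'I_r.+1]) S2 i|%:R + #|S3|%:R)).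
      rewrite -!natrD ler_nat; apply: leq_trans (leq_card_setU _ _) _.
      by rewrite leq_add2r leq_card_setU.
    rewrite !lerD ?union_bound //.
    by apply: le_trans (union_bound b2) _; rewrite cardsT card_ord.
  have Y1 : 1 <= (2 * r.+1%:R) ^+ k * N%:R ^+ k :> R.
    by rewrite -exprMn exprn_ege1 // -!natrM ler1n; nia.
  have r1 : 1 <= r.+1%:R :> R by rewrite ler1n.
  have le3 : #|I1|%:R + r.+1%:R + 1 <= 3 * r.+1%:R * (2 * r.+1%:R) ^+ k * N%:R ^+ k :> R.
    have aux (a c Y : R) : a <= Y * c -> 1 <= Y -> 1 <= c -> a + c + 1 <= 3 * c * Y by nra.
    by rewrite -[leRHS]mulrA; apply: aux.
  apply: (@le_trans _ _ ((#|I1|%:R + r.+1%:R + 1) * beta)); first by rewrite 2!mulrDl mul1r.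
  apply: le_trans (ler_wpM2r beta0 le3) _.
  by rewrite mulrA ler_wpM2r.
exists (~: U).
  rewrite cardsCs setCK natrB ?max_card // card_ffun card_ord; lra.
move=> f; rewrite !inE !negb_or => /andP[/andP[nf1 nf2] nf3]; split.
- move=> e i fe ek ei.
  have := subset_leq_card (faithful_ext fe ei) => /leq_trans /(_ (leq_card_setU _ _)).
  rewrite -(ler_nat R) => /le_trans; apply; rewrite natrD; apply: lerD.
    by rewrite ler_nat (leq_trans (leq_imset_card _ _)) // ltnW.
  have : f \notin S1 (e, i).
    apply: contraNN nf1 => fS; apply/bigcupP; exists (e, i) => //.
    by rewrite inE /= ek; apply/forall_inP.
  by rewrite inE -ltNge => /ltW.
- move=> i; have : f \notin S2 i.
    by apply: contraNN nf2 => fS; apply/bigcupP; exists i.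
  rewrite inE -ltNge.
  have -> : [set p in ~: set0 | f p \in ~: hits i] = ~: positions f i.
    by apply/setP => p; rewrite !inE.
  rewrite cardsCs setCK natrB ?max_card // card_ord; lra.
- move: nf3; rewrite -ltNge.
  have -> : [set p in ~: set0 | f p \in Mc] = [set p | f p \in Mc].
    by apply/setP => p; rewrite !inE.
  exact: ltW.
Qed.
End Sampling.

(** * Assembling the proof *)

(* Here m is the density of matched cells and L a block length; the uncovered
   proportion 9 k^2 alpha outweighs the losses in the degree conditions. *)
Lemma edge_count_slack (R : realFieldType) (k r N mu alpha m K L : R) :
  1 <= k -> 1 <= r -> 0 < alpha -> r * k <= alpha * N -> 1 <= r * mu -> 0 < N ->
  k * m <= mu * (r - 9 * k ^+ 2 * r * alpha) -> K <= (m + alpha / r) * N ->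
  mu * N / k - alpha * mu * N - 2 * (alpha / r) * N - k - 1 <= L ->
  K + alpha * N <= r * L.
Proof.
move=> k1 r1 a0 Nbig rmu N0 mle KN leL.
have k0 : 0 < k by lra.
have r0 : 0 < r by lra.
have mle' : m <= mu * r / k - 9 * k * (r * mu) * alpha.
  rewrite -(ler_pM2l k0); apply: le_trans mle _.
  rewrite le_eqVlt; apply/orP; left; apply/eqP; field; lra.
have aN : 0 < alpha * N by rewrite mulr_gt0.
have e0 : alpha / r <= alpha by rewrite ler_pdivrMr // ler_peMr // ltW.
have eN : alpha / r * N <= alpha * N by rewrite ler_pM2r.
have mN := ler_wpM2r (ltW N0) mle'.
have leL' := ler_wpM2l (ltW r0) leL.
have E1 : r * (mu * N / k - alpha * mu * N - 2 * (alpha / r) * N - k - 1) =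
  mu * r / k * N - (r * mu) * (alpha * N) - 2 * (alpha * N) - r * k - r.
  by field; lra.
rewrite E1 in leL'.
have rk : r <= r * k by rewrite ler_peMr // ltW.
(* The 9k term must pay (r mu) alpha N, 2 alpha N, r k + r <= 2 alpha N, alpha N for the error in K
   and the alpha N claimed. Beyond the first that is six times alpha N; eight are available as k >=
   1 and r mu >= 1. *)
have big : 8 * (alpha * N) <= (9 * k - 1) * (r * mu) * (alpha * N).
  rewrite ler_pM2r //; nra.
have E2 : (mu * r / k - 9 * k * (r * mu) * alpha) * N =
  mu * r / k * N - (9 * k) * (r * mu) * (alpha * N) by ring.
rewrite E2 in mN.
move: leL' mN KN; rewrite mulrDl; move: (mu * r / k * N) => y; lra.
Qed.

(** Via [cheap_edge] with blocks of length L, the hypothesis of [fractional_matching] holds for nu =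
    (r+1) L, and [edge_count_slack] gives K + alpha N <= nu. Since eps nu = alpha L <= alpha N, it
    follows that K <= (1 - eps) nu. *)
Lemma template_fractional (R : realType) (T C : finType) (r : nat) (part : T -> 'I_r.+1) (own : T -> C)
    (J : {set {set T}}) (k N D : nat) (alpha mu : R) (Mc : {set C})
    (f : {ffun 'I_N -> C}) :
  let eps := alpha / r.+1%:R in
  (0 < k)%N -> (k <= r.+1)%N -> 0 < alpha -> alpha < 1 -> set0 \in J ->
  r.+1%:R * k%:R <= alpha * N%:R -> 1 <= r.+1%:R * mu -> mu <= 1 -> (0 < N)%N ->
  k%:R * (#|Mc|%:R / #|C|%:R) <= mu * (r.+1%:R - 9 * k%:R ^+ 2 * r.+1%:R * alpha) ->
  (N * r.+1)%:R < (1 + eps ^+ 3) ^+ D ->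
  (forall e i, faithful part own J f e -> (#|e| < k)%N -> (forall x, x \in e -> x.2 != i) ->
     #|[set p in positions part own f i | ~~ faithful part own J f ((p, i) |: e)]|%:R <=
       k%:R + ((#|e|%:R / k%:R + alpha) * mu + eps) * N%:R) ->
  (forall i, (mu - eps) * N%:R <= #|positions part own f i|%:R) ->
  #|[set p | f p \in Mc]|%:R <= (#|Mc|%:R / #|C|%:R + eps) * N%:R ->
  exists es : seq {set 'I_N * 'I_r.+1},
    [/\ size es = (#|[set p | f p \in Mc]| * D).+1,
        {subset es <= template_edges part own k J f} &
        forall x, (count (fun e : {set 'I_N * 'I_r.+1} => x \in e) es <= D)%N].
Proof.
move=> eps k0 kr a0 a1 J0 Nbig rmu mu1 N0 mle Dbig ext posV cK.
set K := #|[set p | f p \in Mc]| in cK *.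
have k1 : 1 <= k%:R :> R by rewrite ler1n.
have kR : 0 < k%:R :> R by lra.
have r1 : 1 <= r.+1%:R :> R by rewrite ler1n.
have NR : 0 < N%:R :> R by rewrite ltr0n.
have mu0 : 0 < mu by nra.
have eps0 : 0 < eps by rewrite divr_gt0.
(* Exactly (mu - eps) N minus the value at k - 1 of [bd] below, so the last block fits into each
   part. It is also at most the increment mu N / k of [bd], so consecutive blocks do not overlap. *)
pose arg := mu * N%:R / k%:R - alpha * mu * N%:R - 2 * eps * N%:R - k%:R.
pose L := Num.trunc arg.
have argL : arg - 1 <= L%:R.
  by rewrite lerBlDr natr1; apply/ltW/truncnS_gt.
have slack := edge_count_slack k1 r1 a0 Nbig rmu NR mle cK argL.
have aN : 0 < alpha * N%:R by rewrite mulr_gt0.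
have K0 : 0 <= K%:R :> R by [].
have rL0 : 0 < r.+1%:R * L%:R :> R by lra.
have L0 : (0 < L)%N by move: rL0; rewrite pmulr_rgt0 ?ltr0n.
have arg0 : 0 <= arg by move: L0; rewrite truncn_gt0; lra.
have Larg : L%:R <= arg by rewrite truncn_le.
have step0 : 0 <= mu * N%:R / k%:R by rewrite divr_ge0 // mulr_ge0 // ltW.
have amu0 : 0 <= alpha * mu * N%:R by rewrite !mulr_ge0 ?ltW.
have eN0 : 0 <= eps * N%:R by rewrite mulr_ge0 // ltW.
have LN : L%:R <= N%:R :> R.
  have : mu * N%:R / k%:R <= N%:R.
    rewrite ler_pdivrMr //; apply: (@le_trans _ _ (1 * N%:R)); first by rewrite ler_pM2r.
    by rewrite mul1r ler_peMr.
  by move: Larg; rewrite /arg; lra.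
pose bd (j : nat) : R := k%:R + ((j%:R / k%:R + alpha) * mu + eps) * N%:R.
have bdE j : bd j = k%:R + j%:R * (mu * N%:R / k%:R) + alpha * mu * N%:R + eps * N%:R.
  by rewrite /bd; field; rewrite gt_eqF.
have bd0 j : 0 <= bd j.
  by rewrite bdE !addr_ge0 // mulr_ge0.
pose s j := Num.trunc (bd j).
have sbd j : (s j)%:R <= bd j by rewrite truncn_le.
have e1 : eps < 1 by rewrite ltr_pdivrMr; lra.
apply: (@fractional_matching R _ _ (r.+1 * L)%:R eps) => //.
- by rewrite natrM; have : 1 <= r.+1%:R * k%:R :> R by [nra]; lra.
- rewrite natrM mulrBl mul1r.
  have : eps * (r.+1%:R * L%:R) <= alpha * N%:R.
    by rewrite mulrA divfK ?gt_eqF ?ler_pM2l //; lra.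
  lra.
- by rewrite card_prod !card_ord.
move=> a a_ge0.
have [|||||||e [fe ce le]] := @cheap_edge R _ r k L (positions part own f) (faithful part own J f) s _ _ _ _ _ _ _ a a_ge0.
- by [].
- by [].
- by [].
- rewrite /faithful; have -> : trace part own f set0 = set0.
    by apply/setP => v; rewrite in_set0; apply/negP => /traceP [x []]; rewrite in_set0.
  rewrite J0 !cards0 eqxx !andbT; apply/dinjectiveP => x y; by rewrite in_set0.
- by move=> e i fe ek ei; rewrite truncn_ge_nat //; apply: ext.
- move=> j _; rewrite truncn_ge_nat // natrD; apply: (le_trans (lerD (sbd j) Larg)).
  rewrite !bdE -natr1 /arg; lra.
- move=> i; rewrite -(ler_nat R); apply: le_trans (posV i).
  rewrite natrD; apply: (le_trans (lerD (sbd _) Larg)); rewrite bdE /arg.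
  have -> : k.-1%:R * (mu * N%:R / k%:R) = mu * N%:R - mu * N%:R / k%:R.
    have -> : k.-1%:R = k%:R - 1 :> R by rewrite -[in RHS](prednK k0) -natr1 addrK.
    by field; rewrite gt_eqF.
  lra.
exists e => //; rewrite inE ce eqxx /=; move: fe => /and3P[-> tJ /eqP te].
by rewrite /= inE tJ te ce eqxx.
Qed.

(** * Cells of a matching *)

Section Cells.
Variables (T : finType) (r : nat) (part : T -> 'I_r) (k : nat) (J M : {set {set T}}).
Hypothesis partJ : partite part J.
Hypothesis MJ : M \subset layer J k.
Hypothesis matchM : matching M.
Hypothesis k0 : (0 < k)%N.

Lemma matching_trivIset : trivIset M.
Proof. by apply/trivIsetP => A B; apply: matchM. Qed.

Lemma matching_card : (k * #|M| + #|~: cover M|)%N = #|T|.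
Proof.
rewrite -(cardsC (cover M)); congr addn.
have /eqP <- := matching_trivIset; rewrite mulnC -sum_nat_const.
by apply: eq_bigr => e /(subsetP MJ); rewrite inE => /andP[_ /eqP ->].
Qed.

Definition own_set (v : T) : {set T} := if v \in cover M then pblock M v else [set v].

Definition cells : {set {set T}} := own_set @: [set: T].

Lemma own_set_in v : own_set v \in cells.
Proof. exact: imset_f. Qed.

Definition owner (v : T) : {c : {set T} | c \in cells} := Sub (own_set v) (own_set_in v).

Lemma mem_own v : v \in own_set v.
Proof. by rewrite /own_set; case: ifP => vM; rewrite ?mem_pblock ?in_set1. Qed.

(** Edges of M are partite and the other cells are singletons. *)
Lemma owner_inj u v : part u = part v -> owner u = owner v -> u = v.
Proof.
move=> puv /(congr1 val) /= ouv; have := mem_own v; have := mem_own u; rewrite -ouv.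
rewrite /own_set; case: ifP => uM; last by rewrite !in_set1 => _ /eqP.
move=> uB vB; have /(subsetP MJ) := pblock_mem uM; rewrite inE => /andP[/partJ /(_ (part u))].
by move/card_le1_eqP => le1 _; apply: le1; rewrite !inE ?uB ?vB ?puv eqxx.
Qed.

Definition matched_cells : {set {c : {set T} | c \in cells}} := [set c | val c \in M].

Lemma cell_matched c : c \in matched_cells -> cell owner c = val c.
Proof.
rewrite inE => cM; apply/setP => v; rewrite inE; apply/eqP/idP => [<-|vc]; first exact: mem_own.
apply: val_inj => /=; rewrite /own_set.
have -> : v \in cover M by apply/bigcupP; exists (val c).
exact: def_pblock matching_trivIset cM vc.
Qed.

Lemma card_matched_cells : #|matched_cells| = #|M|.
Proof.
rewrite -(card_imset _ val_inj); apply: eq_card => e.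
apply/imsetP/idP => [[c cM ->]|eM]; first by rewrite inE in cM.
have /card_gt0P [v ve] : (0 < #|e|)%N.
  by have := subsetP MJ _ eM; rewrite inE => /andP[_ /eqP ->].
have ev : own_set v = e.
  rewrite /own_set (def_pblock matching_trivIset eM ve).
  by case: ifP => // /negP[]; apply/bigcupP; exists e.
by exists (owner v); rewrite ?inE /= ev.
Qed.

Lemma card_cells : (#|{: {c : {set T} | c \in cells}}| <= #|T|)%N.
Proof. by rewrite card_sig -cardsT; apply: leq_imset_card. Qed.
End Cells.

Theorem theorem2p4 (R : realType) (k r : nat) :
  (0 < k)%N -> (k <= r)%N ->
  exists alpha0 : R, 0 < alpha0 /\
  forall alpha : R, 0 < alpha -> alpha < alpha0 ->
  exists n0 : nat, forall n : nat, (n0 <= n)%N ->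
  forall (T : finType) (part : T -> 'I_r),
    (forall i : 'I_r, #|Vpart part i| = n) ->
  forall J : {set {set T}},
    k_system k J -> partite part J ->
    partite_mindeg_ge part k J
      (fun j => if j == 0%N then n%:R
                else ((k - j)%:R / k%:R - alpha) * n%:R) ->
  exists M : {set {set T}},
    M \subset layer J k /\ matching M /\
    (#|~: cover M|%:R <= 9 * (k ^ 2)%:R * r%:R * alpha * n%:R).
Proof.
move=> k0; case: r => [|r] kr; first by lia.
(* The bound alpha < 1 suffices, because N, D and n0 are all chosen after alpha. *)
exists 1; split=> // alpha a0 a1.
have k1 : 1 <= k%:R :> R by rewrite ler1n.
have kR : 0 < k%:R :> R by lra.
have r1 : 1 <= r.+1%:R :> R by rewrite ler1n.
have rR : 0 < r.+1%:R :> R by lra.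
pose eps := alpha / r.+1%:R.
have eps0 : 0 < eps by rewrite divr_gt0.
have eps1 : eps <= 1 by rewrite ler_pdivrMr //; lra.
have c0 : 0 < eps ^+ 2 / 16 by rewrite divr_gt0 // exprn_gt0.
have [N0 N0P] := poly_exp_small (3 * r.+1%:R * (2 * r.+1%:R) ^+ k) k c0.
(* N serves the union bound over bad events and makes alpha N dominate the additive losses. *)
pose N := (maxn N0 (Num.bound (r.+1%:R * k%:R / alpha))).+1.
have N1 : (0 < N)%N by [].
have Nbig : r.+1%:R * k%:R <= alpha * N%:R.
  rewrite [leRHS]mulrC -ler_pdivrMr //; apply: le_trans (ltW (archi_boundP _)) _.
    by rewrite divr_ge0 ?mulr_ge0 ?ltW.
  by rewrite ler_nat leqW ?leq_maxr.
have small := N0P N (leqW (leq_maxl _ _)).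
have e3 : 0 < eps ^+ 3 by rewrite exprn_gt0.
(* By Bernoulli's inequality this D makes (1 + eps^3)^(D+1) exceed the number N (r+1) of template
   vertices. *)
pose D := Num.bound ((N * r.+1)%:R / eps ^+ 3).
have Dbig : (N * r.+1)%:R < (1 + eps ^+ 3) ^+ D.+1.
  apply: lt_le_trans (bernoulli _ (ltW e3)).
  have : (N * r.+1)%:R / eps ^+ 3 < D%:R by apply: archi_boundP; rewrite divr_ge0 // ltW.
  by rewrite ltr_pdivrMr // -[D.+1%:R]natr1; lra.
(* A type records the edges of a template and the positions of its matched cells. The number of
   types depends on N and r only, so the density passed to [blowup] is independent of n. *)
pose types := ({set {set 'I_N * 'I_r.+1}} * {set 'I_N})%type.
have t0 : (0 < #|{: types}|)%N by apply/card_gt0P; exists (set0, set0).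
have d0 : 0 < 1 / 2 / #|{: types}|%:R :> R by rewrite !divr_gt0 // ltr0n.
have [n0 n0P] := blowup D.+1 N d0.
exists (maxn 1 n0) => n; rewrite geq_max => /andP[n1 nn0] T part cpart J [J0 Jk] partJ deg.
have nR : 0 < n%:R :> R by rewrite ltr0n.
have cT : #|T| = (r.+1 * n)%N.
  rewrite -sum1_card (partition_big part xpredT) //=.
  transitivity (\sum_(i < r.+1) n)%N; last by rewrite sum_nat_const card_ord.
  by apply: eq_bigr => i _; rewrite sum1dep_card -(cpart i).
(* One formula for all layers: at the empty edge it reads (1 - alpha) n, which the bound n
   dominates. *)
have degJ e i : e \in J -> (#|e| < k)%N -> [disjoint e & Vpart part i] ->
    ((k - #|e|)%:R / k%:R - alpha) * n%:R <= #|ext_nbhd part J e i|%:R.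
  move=> eJ ek ei; have eL : e \in layer J #|e| by rewrite inE eJ eqxx.
  have := deg _ ek e eL i ei.
  case: eqP => [-> le|_ //]; apply: le_trans le.
  by rewrite subn0 divff ?gt_eqF // ler_piMl // lerBlDr lerDl ltW.
(* Augmentation is repeated from the empty matching; it must stop because no matching in J has more
   than [#|J|] edges. *)
suff improve (M : {set {set T}}) : M \subset layer J k -> matching M ->
    9 * (k ^ 2)%:R * r.+1%:R * alpha * n%:R < #|~: cover M|%:R ->
    exists M' : {set {set T}}, [/\ M' \subset layer J k, matching M' & (#|M| < #|M'|)%N].
  have climb m : (exists M : {set {set T}}, M \subset layer J k /\ matching M /\
      (#|~: cover M|%:R <= 9 * (k ^ 2)%:R * r.+1%:R * alpha * n%:R)) \/
      exists M : {set {set T}}, [/\ M \subset layer J k, matching M & (m <= #|M|)%N].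
    elim: m => [|m [ok|[M [MJ mM cM]]]]; [right|by left|].
      by exists set0; split; [exact: sub0set | move=> e e'; rewrite inE |].
    case: (lerP #|~: cover M|%:R (9 * (k ^ 2)%:R * r.+1%:R * alpha * n%:R)) => [le|lt].
      by left; exists M.
    have [M' [M'J mM' lt']] := improve M MJ mM lt.
    by right; exists M'; split=> //; apply: leq_ltn_trans cM lt'.
  have [//|[M [MJ _ cM]]] := climb #|J|.+1.
  have : (#|layer J k| <= #|J|)%N by apply/subset_leq_card/subsetP => e; rewrite inE => /andP[].
  by move/(leq_trans (leq_trans cM (subset_leq_card MJ))); rewrite ltnn.
move=> MJ mM big.
pose C := {c : {set T} | c \in cells M}; pose own : T -> C := owner M.
have oinj u v : part u = part v -> own u = own v -> u = v by apply: owner_inj partJ MJ _ _.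
pose Mc := matched_cells M.
have nC : (n <= #|{: C}|)%N by rewrite -(card_hits oinj cpart ord0) max_card.
have C0 : (0 < #|{: C}|)%N by apply: leq_trans n1 nC.
have CR : 0 < #|{: C}|%:R :> R by rewrite ltr0n.
pose mu : R := n%:R / #|{: C}|%:R.
have rmu : 1 <= r.+1%:R * mu.
  by rewrite mulrA ler_pdivlMr // mul1r -natrM ler_nat -cT card_cells.
have mu1 : mu <= 1 by rewrite ler_pdivrMr // mul1r ler_nat.
(* The number k |M| of covered vertices is (r+1) n minus the uncovered ones; divide by the number of
   cells. *)
have mle : k%:R * (#|Mc|%:R / #|{: C}|%:R) <= mu * (r.+1%:R - 9 * k%:R ^+ 2 * r.+1%:R * alpha).
  rewrite mulrA [leRHS]mulrAC ler_pM2r ?invr_gt0 // (card_matched_cells MJ mM k0).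
  have := matching_card MJ mM; rewrite cT => /(congr1 (fun m => m%:R : R)).
  move: big; rewrite natrD !natrM; nra.
have [H Hbig HP] := @sampled_templates R T C r part own J k n alpha oinj cpart (ltW a0) (ltW a1) degJ
  N eps Mc C0 eps0 eps1 N1 small.
pose type (f : {ffun 'I_N -> C}) : types := (template_edges part own k J f, [set p | f p \in Mc]).
have CN0 : 0 < (#|{: C}| ^ N)%:R :> R by rewrite ltr0n expn_gt0 C0.
have H0 : (0 < #|H|)%N.
  by rewrite -(ltr_nat R); apply: lt_le_trans Hbig; rewrite !mulr_gt0 ?invr_gt0.
have [f fH|tau _ Hle] := @pigeonhole_cover _ _ [set: types] H (fun t => [set f in H | type f == t]) H0.
  by exists (type f); rewrite inE ?fH ?eqxx.
set Ht := [set f in H | type f == tau] in Hle.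
have Htbig : 1 / 2 / #|{: types}|%:R * (#|{: C}| ^ N)%:R <= #|Ht|%:R :> R.
  rewrite mulrAC ler_pdivrMr ?ltr0n //; apply: le_trans Hbig _.
  by rewrite mulrC -natrM ler_nat -cardsT.
have [b bI bH] := n0P C Ht (leq_trans nn0 nC) Htbig.
have [f0 f0Ht] : exists f0, f0 \in Ht.
  by apply/card_gt0P; rewrite -(ltr_nat R); apply: lt_le_trans Htbig; rewrite mulr_gt0.
(* All templates of the blow-up have type [tau], so the edge family found in the single template
   [f0] is valid in each of them. *)
move: (f0Ht); rewrite inE => /andP[/HP [ext posV cK] /eqP tf0].
have [es [szes esE esD]] := template_fractional k0 kr a0 a1 J0 Nbig rmu mu1 N1 mle Dbig ext posV cK.
have [||||M' [M'J mM' lt]] := @augment T C r.+1 part own k N D J Mc tau.1 tau.2 b es k0 _ bI _ _ _ esD.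
- by move=> c cM; rewrite cell_matched //; apply: (subsetP MJ); rewrite inE in cM.
- by move=> phi f; have := bH phi; rewrite inE => /andP[_ /eqP <-]; split.
- by rewrite szes -tf0.
- by rewrite -tf0.
by exists M'; rewrite -(card_matched_cells MJ mM k0).
Qed.
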